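(* Let $d=1$, let $(\Omega,\mathcal{F},\mathbb{P})$ be a probability space with an invertible ergodic measure-preserving transformation $T$, and let $p^+,p^-:\Omega\to[0,1]$ be measurable with $p^++p^-=1$. Suppose $\int|\log p^{\pm}(\omega)|\,d\mathbb{P}<\infty$. Then for every $\lambda\in\mathbb{R}$, for $\mathbb{P}$-almost every $\omega$, $$\lim_{n\to\infty}\frac1n\log E^{P_\omega}\left[\mathrm{e}^{\lambda X_n}\right]=\Lambda(\lambda).$$
   Context: $P_\omega$ is the law of the random walk $(X_n)$ on $\mathbb{Z}$ with $X_0=0$ which, from $x$, steps to $x+1$ with probability $p^+(T^x\omega)$ and to $x-1$ with probability $p^-(T^x\omega)$. The class $\mathcal{K}$ consists of pairs of functions $F^\pm\in L^1(\mathbb{P})$ with $\mathbb{E}[F^\pm]=0$ and $F^+(\omega)+F^-(T\omega)=0$. Define $$\Lambda(\lambda)=\inf_{F\in\mathcal{K}}\operatorname*{ess\,sup}_\omega\log\left\{p^+(\omega)\mathrm{e}^{\lambda+F^+(\omega)}+p^-(\omega)\mathrm{e}^{-\lambda+F^-(\omega)}\right\},$$ the essential supremum with respect to $\mathbb{P}$. *)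

(* Defs.v *)
From HB Require Import structures.
From mathcomp Require Import all_boot all_order all_algebra.
From mathcomp Require Import all_classical all_reals all_analysis.
From mathcomp Require Import ess_sup_inf.
Set Implicit Arguments. Unset Strict Implicit. Unset Printing Implicit Defensive.
Import Order.TTheory GRing.Theory Num.Theory.
Import numFieldNormedType.Exports.
Local Open Scope classical_set_scope.
Local Open Scope ring_scope.

Definition Tpow {X : Type} (T Tinv : X -> X) (z : int) : X -> X :=
  match z with
  | Posz n => iter n T
  | Negz n => iter n.+1 Tinv
  end.

Definition elog {R : realType} (x : R) : \bar R :=
  if 0 < x then (ln x)%:E else -oo%E.

Definition pos {n : nat} (s : {ffun 'I_n -> bool}) (k : nat) : int :=
  \sum_(i < n | (i < k)%N) (if s i then 1 else -1).

(* Quenched expectation E^{P_omega}[exp(lambda X_n)] for the walk started at 0: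
   sum over all n-step paths of (path probability) * exp(lambda * X_n). *)
Definition quenched_mgf {X : Type} {R : realType} (T Tinv : X -> X)
  (pp pm : X -> R) (w : X) (lam : R) (n : nat) : R :=
  \sum_(s : {ffun 'I_n -> bool})
    ((\prod_(k < n)
        (if s k then pp (Tpow T Tinv (pos s k) w)
                else pm (Tpow T Tinv (pos s k) w)))
     * expR (lam * (pos s n)%:~R)).

Definition classK {d} {X : measurableType d} {R : realType}
  (P : probability X R) (T : X -> X) (Fp Fm : X -> R) : Prop :=
  [/\ P.-integrable setT (EFin \o Fp), P.-integrable setT (EFin \o Fm),
      (\int[P]_w (Fp w)%:E = 0)%E, (\int[P]_w (Fm w)%:E = 0)%E &
      {ae P, forall w, Fp w + Fm (T w) = 0}].

Definition Lambda {d} {X : measurableType d} {R : realType}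
  (P : probability X R) (T : X -> X) (pp pm : X -> R) (lam : R) : \bar R :=
  ereal_inf [set y | exists Fp Fm : X -> R, classK P T Fp Fm /\
     y = ess_sup P (fun w => (ln (pp w * expR (lam + Fp w)
                                  + pm w * expR (- lam + Fm w)))%:E)].

(* Main.v *)
(** Upper bound. For [F] in the class K, let [phi] be the potential on [Z] with
    [phi (x + 1) - phi x = F+ (T^x w)]. If the essential supremum in the definition
    of [Lambda] is at most [q] for this [F], then
    [E_w[exp (lam X_n + phi X_n)] <= exp (q n)] by induction on [n], and [phi] is
    sublinear by the ergodic theorem.

    Lower bound. For [s < r] there are two cases. If [E_w[exp (lam X_n)]] is
    almost surely [O(exp (s n))], then the Green function
    [G = sum_n exp (- r n) E[exp (lam X_n)]] is finite, and
    [F+ = log (G o T / G)], [F- = log (G o T^-1 / G)] is an element of K which shows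
    [Lambda <= r].  Otherwise, up to reversing the direction of the walk, a
    zero-one law gives for almost every [w] some [n > 0] with
    [E_w[exp (lam X_n); X_n >= 0] >= exp (s n)], and with large probability
    [n <= N]. Using these [n]-step strategies at good sites and single steps to the
    right at the rare other sites, whose cost per visited site is integrable,
    the walk achieves the rate [s - e] along all times. *)

Require Import Defs.
From HB Require Import structures.
From mathcomp Require Import all_boot all_order all_algebra.
From mathcomp Require Import all_classical all_reals all_analysis.
From mathcomp Require Import ess_sup_inf measurable_realfun.
From mathcomp Require Import ring lra zify.
Set Implicit Arguments. Unset Strict Implicit. Unset Printing Implicit Defensive.
Import Order.TTheory GRing.Theory Num.Theory.
Import numFieldNormedType.Exports.
Local Open Scope classical_set_scope.
Local Open Scope ring_scope.

(** * Ergodic automorphisms *)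

Record ergodic_automorphism {d} {X : measurableType d} {R : realType}
    (P : probability X R) (T Tinv : X -> X) : Prop := ErgodicAutomorphism {
  ea_meas : measurable_fun setT T;
  ea_measV : measurable_fun setT Tinv;
  ea_can : cancel T Tinv;
  ea_canV : cancel Tinv T;
  ea_pres : forall A, measurable A -> P (T @^-1` A) = P A;
  ea_erg : forall A, measurable A -> T @^-1` A = A -> P A = 0%E \/ P A = 1%E
}.

Section ErgodicAutomorphism.
Context {d} {X : measurableType d} {R : realType} {P : probability X R}.
Implicit Types (T Tinv : X -> X) (Q : X -> Prop) (f g : X -> R).

Lemma preimage_measurable T (A : set X) :
  measurable_fun setT T -> measurable A -> measurable (T @^-1` A).
Proof. by move=> mT mA; rewrite -[X in measurable X]setTI; exact: mT. Qed.

(** Lets one-sided results be applied to backward orbits and to the reversed walk. *)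
Lemma ergodic_automorphismV T Tinv :
  ergodic_automorphism P T Tinv -> ergodic_automorphism P Tinv T.
Proof.
case=> mT mTi c ci pres erg; split=> // A mA.
- rewrite -(pres (Tinv @^-1` A)); last exact: preimage_measurable.
  by congr (P _); apply/seteqP; split=> x /=; rewrite /preimage/= c.
- move=> e; apply: erg => //; rewrite -[in LHS]e.
  by apply/seteqP; split=> x /=; rewrite /preimage/= c.
Qed.

Lemma ae_and (Q1 Q2 : X -> Prop) : {ae P, forall w, Q1 w} ->
  {ae P, forall w, Q2 w} -> {ae P, forall w, Q1 w /\ Q2 w}.
Proof. by apply: filterS2. Qed.

Lemma ae_comp T Tinv (ET : ergodic_automorphism P T Tinv) Q :
  {ae P, forall w, Q w} -> {ae P, forall w, Q (T w)}.
Proof.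
case=> N [mN N0 QN]; exists (T @^-1` N); split.
- exact: preimage_measurable (ea_meas ET) mN.
- by rewrite (ea_pres ET).
- by move=> w /= nQ; apply: QN.
Qed.

Lemma ae_iter T Tinv (ET : ergodic_automorphism P T Tinv) Q :
  {ae P, forall w, Q w} -> {ae P, forall w, forall n, Q (iter n T w)}.
Proof.
move=> aQ; apply: ae_foralln => n; elim: n => [//|n IH].
by have := ae_comp ET IH; apply: filterS => w; rewrite -iterSr.
Qed.

Lemma ae_orbit T Tinv (ET : ergodic_automorphism P T Tinv) Q :
  {ae P, forall w, Q w} -> {ae P, forall w, forall z, Q (Tpow T Tinv z w)}.
Proof.
move=> aQ; have := ae_iter (ergodic_automorphismV ET) aQ.
have := ae_iter ET aQ; apply: filterS2 => w h1 h2 [n|n]; first exact: h1.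
exact: h2.
Qed.

Lemma ae_measure1 (A : set X) : measurable A -> P A = 1%E ->
  {ae P, forall w, A w}.
Proof.
move=> mA PA; exists (~` A); split=> //; first exact: measurableC.
by rewrite probability_setC// PA subee.
Qed.

Lemma ae_measure0 (A : set X) : measurable A -> P A = 0%E ->
  {ae P, forall w, ~ A w}.
Proof. by move=> mA PA; exists A; split=> // w /contrapT. Qed.

(** [A] and its preimage have equal measure, so the almost sure inclusion is an almost sure
    equality; [A] is then replaced by a strictly invariant set. *)
Lemma ergodic_zero_one T Tinv (ET : ergodic_automorphism P T Tinv)
    (A : set X) : measurable A -> {ae P, forall w, A (T w) -> A w} ->
  {ae P, forall w, A w} \/ {ae P, forall w, ~ A w}.
Proof.
move=> mA aTA.
have mTA := preimage_measurable (ea_meas ET) mA.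
have aAT : {ae P, forall w, A w -> A (T w)}.
  have e0 : P (T @^-1` A `\` A) = 0%E.
    apply: measure_negligible; first exact: measurableD.
    by apply: negligibleS aTA => w [? ?] /=; auto.
  have e1 : P (A `\` T @^-1` A) = 0%E.
    have DI B C : measurable B -> measurable C ->
      P B = (P (B `\` C) + P (B `&` C))%E by move=> mB mC; exact: measureDI.
    have := DI _ _ mA mTA; rewrite -(ea_pres ET mA) (DI _ _ mTA mA) e0 add0e.
    rewrite [A `&` _]setIC => e.
    have fI : P (T @^-1` A `&` A) \is a fin_num.
      by rewrite fin_num_measure//; exact: measurableI.
    by rewrite -[LHS](addeK _ fI) -e subee.
  exists (A `\` T @^-1` A); split=> //; first exact: measurableD.
  by move=> w /= /not_implyP[].
have aiff : {ae P, forall w, forall n, A (iter n T w) <-> A w}.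
  have := ae_iter ET aTA; have := ae_iter ET aAT.
  apply: filterS2 => w h1 h2; elim=> [//|n IH]; split=> [/h2/IH|/IH/h1]//.
(* Points whose orbit enters [A] infinitely often: strictly invariant, and equal to [A] up to a null
   set. *)
pose B := \bigcap_n \bigcup_m (fun w => iter (n + m) T w) @^-1` A.
have mit n : measurable_fun setT (fun w => iter n T w).
  elim: n => [|n IH]; first exact: measurable_id.
  exact: measurableT_comp (ea_meas ET) IH.
have mB : measurable B.
  apply: bigcap_measurable; first by exists 0%N.
  by move=> n _; apply: bigcup_measurable => m _; exact: preimage_measurable.
have TB : T @^-1` B = B.
  apply/seteqP; split=> w /= Bw n _.
  - have [m _ h] := Bw n I; exists m.+1 => //.
    by move: h; rewrite /preimage /= addnS iterSr.
  - have [m _ h] := Bw n.+1 I; exists m => //.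
    by rewrite /preimage /= -iterSr.
have BA w : (forall n, A (iter n T w) <-> A w) -> (B w <-> A w).
  move=> h; split=> [/(_ 0%N I)[m _]/= /h//|Aw n _]; exists 0%N => //.
  exact/h.
case: (ea_erg ET mB TB) => [/(ae_measure0 mB) aB|/(ae_measure1 mB) aB].
- by right; move: aB aiff; apply: filterS2 => w nB /BA <-.
- by left; move: aB aiff; apply: filterS2 => w Bw /BA <-.
Qed.

Lemma integrable_measurable f :
  P.-integrable setT (EFin \o f) -> measurable_fun setT f.
Proof. by move=> fi; apply/measurable_EFinP; exact: measurable_int fi. Qed.

Lemma integral_pushforward_pres T Tinv (ET : ergodic_automorphism P T Tinv)
    (h : X -> \bar R) :
  (\int[P]_x h x = \int[pushforward P T]_x h x)%E.
Proof.
apply: eq_measure_integral => //=; first exact: ea_meas ET.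
by move=> mT A mA _ /=; rewrite /pushforward (ea_pres ET).
Qed.

Lemma integrable_comp T Tinv (ET : ergodic_automorphism P T Tinv) f :
  P.-integrable setT (EFin \o f) -> P.-integrable setT (EFin \o (f \o T)).
Proof.
move=> fi; have mf := integrable_measurable fi; apply/integrableP; split.
  by apply/measurable_EFinP; exact: measurableT_comp mf (ea_meas ET).
have /integrableP[_] := fi; apply: le_lt_trans.
rewrite [leRHS](integral_pushforward_pres ET) ge0_integral_pushforward//=.
- exact: ea_meas ET.
- by do 2 apply: measurableT_comp => //.
Qed.

Lemma integral_comp T Tinv (ET : ergodic_automorphism P T Tinv) f :
  P.-integrable setT (EFin \o f) ->
  (\int[P]_w (f (T w))%:E = \int[P]_w (f w)%:E)%E.
Proof.
move=> fi; have mf := integrable_measurable fi.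
have mf' : measurable_fun setT (fun x => (f x)%:E) by exact/measurable_EFinP.
rewrite [RHS](integral_pushforward_pres ET).
by rewrite (integral_pushforward (ea_meas ET) mf' (integrable_comp ET fi)).
Qed.

End ErgodicAutomorphism.

(** * The ergodic theorem *)

Section BirkhoffSums.
Context {X : Type} {R : realType} (T : X -> X).
Implicit Types b f : X -> R.

Definition birkhoff_sum f (n : nat) (w : X) : R := \sum_(i < n) f (iter i T w).

Lemma birkhoff_sumS f n w :
  birkhoff_sum f n.+1 w = f w + birkhoff_sum f n (T w).
Proof.
rewrite /birkhoff_sum big_ord_recl /=; congr (_ + _).
by apply: eq_bigr => i _; rewrite -iterSr.
Qed.

Lemma birkhoff_sumD b n m w :
  birkhoff_sum b (n + m) w = birkhoff_sum b n w + birkhoff_sum b m (iter n T w).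
Proof.
rewrite /birkhoff_sum big_split_ord /=; congr (_ + _).
by apply: eq_bigr => i _; rewrite addnC iterD.
Qed.

Lemma birkhoff_sum_ge0 b n w : (forall v, 0 <= b v) -> 0 <= birkhoff_sum b n w.
Proof. by move=> b0; apply: sumr_ge0. Qed.

Lemma birkhoff_sum_le b n m k w : (forall v, 0 <= b v) -> (n + m <= k)%N ->
  birkhoff_sum b m (iter n T w) <= birkhoff_sum b k w.
Proof.
move=> b0 /subnKC <-; rewrite !birkhoff_sumD.
have := birkhoff_sum_ge0 n w b0.
by have := birkhoff_sum_ge0 (k - (n + m)) (iter (n + m) T w) b0; lra.
Qed.

End BirkhoffSums.

(** * Maximal sums and coboundaries *)

Section Birkhoff.
Context {d} {X : measurableType d} {R : realType} {P : probability X R}.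
Variables (T Tinv : X -> X).
Hypothesis ET : ergodic_automorphism P T Tinv.
Implicit Types (f g : X -> R).

(* [M_n = max (0, S_1 f, ..., S_n f)] *)
Fixpoint birkhoff_max f (n : nat) (w : X) : R :=
  if n is m.+1 then Num.max 0 (f w + birkhoff_max f m (T w)) else 0.

Lemma birkhoff_max_ge0 f n w : 0 <= birkhoff_max f n w.
Proof. by case: n => //= n; rewrite le_max lexx. Qed.

Lemma birkhoff_sum_le_max f n w : birkhoff_sum T f n w <= birkhoff_max f n w.
Proof.
elim: n w => [|n IH] w; first by rewrite /birkhoff_sum big_ord0.
by rewrite birkhoff_sumS /= le_max lerD2l IH orbT.
Qed.

Lemma birkhoff_max_leS f n w : birkhoff_max f n w <= birkhoff_max f n.+1 w.
Proof.
elim: n w => [|n IH] w; first exact: birkhoff_max_ge0.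
rewrite [leLHS]/= ge_max birkhoff_max_ge0 /=.
by rewrite le_max lerD2l; apply/orP; right; exact: IH.
Qed.

Lemma birkhoff_max_le f n m w : (n <= m)%N ->
  birkhoff_max f n w <= birkhoff_max f m w.
Proof.
move=> /subnK <-; elim: (m - n)%N => [//|k IH].
exact: le_trans IH (birkhoff_max_leS _ _ _).
Qed.

Lemma measurable_birkhoff_max f n :
  measurable_fun setT f -> measurable_fun setT (birkhoff_max f n).
Proof.
move=> mf; elim: n => [|n IH] /=; first exact: measurable_cst.
apply: measurable_maxr => //; apply: measurable_funD => //.
exact: measurableT_comp IH (ea_meas ET).
Qed.

Lemma integrable_birkhoff_max f n : P.-integrable setT (EFin \o f) ->
  P.-integrable setT (EFin \o birkhoff_max f n).
Proof.
move=> fi; have mf := integrable_measurable fi.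
elim: n => [|n IH]; first exact: integrable0.
have := integrableD measurableT fi (integrable_comp ET IH).
apply: le_integrable => //.
  by apply/measurable_EFinP; exact: measurable_birkhoff_max.
move=> w _ /=; rewrite lee_fin ger0_norm; last by rewrite le_max lexx.
by rewrite ge_max normr_ge0 ler_norm.
Qed.

(* If the increasing sequence [M_n] were unbounded almost everywhere, then
   [M_(n+1) - M_n \o T = max (- M_n \o T, f)], whose integral is nonnegative by
   invariance, would decrease to [f]. *)
Lemma birkhoff_sum_bounded f : P.-integrable setT (EFin \o f) ->
  (\int[P]_w (f w)%:E < 0)%E ->
  {ae P, forall w, exists C, forall n, birkhoff_sum T f n w <= C}.
Proof.
move=> fi f_lt0; have mf := integrable_measurable fi.
pose M := birkhoff_max f.
have mM n : measurable_fun setT (M n) by exact: measurable_birkhoff_max.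
have iM n : P.-integrable setT (EFin \o M n) by exact: integrable_birkhoff_max.
(* Where [M n] is unbounded in [n]. As [M n.+1 w >= f w + M n (T w)], unboundedness passes from
   [T w] to [w], and the zero-one law applies. *)
pose A := \bigcap_(k in [set: nat]) \bigcup_(n in [set: nat]) [set w | k%:R < M n w].
have mA : measurable A.
  apply: bigcap_measurable; first by exists 0%N.
  move=> k _; apply: bigcup_measurable => n _.
  rewrite -[X in measurable X]setTI.
  have := mM n measurableT _ (measurable_itv `]k%:R, +oo[).
  by congr measurable; apply/seteqP; split=> w /=; rewrite in_itv /= andbT.
have TA w : A (T w) -> A w.
  move=> ATw k _; have [n _ /= hn] := ATw (Num.truncn `|k%:R - f w|).+1 I.
  exists n.+1 => //=; rewrite /M /= lt_max; apply/orP; right; move: hn.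
  have := truncnS_gt `|k%:R - f w|; have := ler_norm (k%:R - f w).
  by rewrite /M; lra.
have [aA|anA] := ergodic_zero_one ET mA (aeW P TA); last first.
  move: anA; apply: filterS => w nA; apply: contrapT => nC; apply: nA => k _.
  apply: contrapT => nk; apply: nC; exists k%:R => n.
  apply: le_trans (birkhoff_sum_le_max _ _ _) _; rewrite leNgt; apply/negP => h.
  by apply: nk; exists n.
exfalso.
pose h n w := Num.max (- M n (T w)) (f w).
have hE n w : h n w = M n.+1 w - M n (T w).
  by rewrite /h /M /= /Num.max; do 2 case: ifPn; lra.
have mh n : measurable_fun setT (EFin \o h n).
  apply/measurable_EFinP; apply: measurable_maxr => //.
  by apply: measurable_funN; exact: measurableT_comp (mM n) (ea_meas ET).
have ih n : (0 <= \int[P]_w (h n w)%:E)%E.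
  under eq_integral do rewrite hE EFinB.
  rewrite integralB_EFin//; last exact: (integrable_comp ET (iM n)).
  rewrite (integral_comp ET (iM n)) sube_ge0; last first.
    by rewrite (integrable_fin_num measurableT (iM n)).
  apply: le_integral; [exact: measurableT|exact: iM|exact: iM|].
  by move=> w _; rewrite lee_fin; exact: birkhoff_max_leS.
(* By monotonicity, [h n w = f w] from the first [n] at which [M n (T w)] exceeds [|f w|]. *)
have hf : {ae P, forall w, setT w -> (EFin \o h n) w @[n --> \oo] --> (f w)%:E}.
  move: (ae_comp ET aA); apply: filterS => w Aw _.
  have /Aw [m _ /= hm] : [set: nat] (Num.truncn `|f w|).+1 by [].
  apply: cvg_near_cst; exists m => // n /= mn; congr (_%:E).
  apply/max_idPr; rewrite lerNl.
  have h1 := birkhoff_max_le f (T w) mn.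
  have h2 : `|f w| < (Num.truncn `|f w|).+1%:R by exact: truncnS_gt.
  have h3 := ler_norm (- f w); rewrite normrN in h3.
  by move: hm h1 h2 h3; rewrite /M; lra.
have hdom : {ae P, forall w n, setT w -> (`|(EFin \o h n) w| <= `|(f w)%:E|)%E}.
  apply: aeW => w n _; rewrite /= lee_fin /h.
  have := birkhoff_max_ge0 f n (T w); rewrite -/(M n (T w)) /Num.max.
  case: ifPn => // + M0; rewrite -leNgt => fM.
  by rewrite normrN ger0_norm// ler0_norm; lra.
have [_ _ cv] := dominated_convergence measurableT mh (measurable_int _ fi) hf
  (integrable_abse fi) hdom.
have : (0 <= \int[P]_w (f w)%:E)%E.
  by apply: cvge_ge cv; apply: nearW => n; exact: ih.
by rewrite leNgt f_lt0.
Qed.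

(** Truncate [g] to [[-k, k]]: the truncated coboundary has integral 0 by invariance. Truncation is
    1-Lipschitz, so [|g o T - g|] dominates and the limit in [k] can be taken although [g] may fail
    to be integrable. *)
Lemma integral_coboundary g : measurable_fun setT g ->
  P.-integrable setT (EFin \o (fun w => g (T w) - g w)) ->
  (\int[P]_w (g (T w) - g w)%:E = 0)%E.
Proof.
move=> mg hi.
pose c (k : nat) (x : R) := Num.max (- k%:R) (Num.min k%:R x).
have ck_le k x : `|c k x| <= k%:R.
  rewrite /c ler_norml; have := ler0n R k; rewrite /Num.max /Num.min.
  by do 2 case: ifPn; lra.
have c_lip k x y : `|c k x - c k y| <= `|x - y|.
  have k0 := ler0n R k; rewrite /c /Num.max /Num.min.
  rewrite ler_norml; have := ler_norm (x - y); have := ler_norm (- (x - y)).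
  by rewrite normrN; repeat case: ifPn; lra.
have mc k : measurable_fun setT (c k \o g).
  apply: measurable_maxr => //; exact: measurable_minr.
have ic k : P.-integrable setT (EFin \o (c k \o g)).
  apply: (@le_integrable _ _ _ _ _ measurableT _ (EFin \o cst k%:R)).
  - exact/measurable_EFinP.
  - by move=> w _ /=; rewrite lee_fin (le_trans (ck_le _ _))// ler_norm.
  - exact: finite_measure_integrable_cst.
have c_cvg x : \forall k \near \oo, c k x = x.
  exists (Num.truncn `|x|).+1 => // k /= hk.
  have h2 : `|x| < (Num.truncn `|x|).+1%:R by exact: truncnS_gt.
  have h3 : (Num.truncn `|x|).+1%:R <= k%:R :> R by rewrite ler_nat.
  have := ler_norm x; have := ler_norm (- x); rewrite normrN /c /Num.max /Num.min.
  by do 2 case: ifPn; lra.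
pose h k w := (c k (g (T w)) - c k (g w)).
have ih k : (\int[P]_w (h k w)%:E = 0)%E.
  under eq_integral do rewrite EFinB.
  rewrite (integralB_EFin measurableT (integrable_comp ET (ic k)) (ic k)).
  rewrite (integral_comp ET (ic k)) subee//.
  exact: (integrable_fin_num measurableT (ic k)).
have mh k : measurable_fun setT (EFin \o h k).
  apply/measurable_EFinP; apply: measurable_funB; last exact: mc.
  exact: measurableT_comp (mc k) (ea_meas ET).
pose hg w := g (T w) - g w.
have hh : {ae P, forall w, setT w ->
    (EFin \o h k) w @[k --> \oo] --> (hg w)%:E}.
  apply: aeW => w _; apply: cvg_near_cst.
  have := c_cvg (g (T w)); have := c_cvg (g w).
  by apply: filterS2 => j e1 e2; rewrite /= /h e1 e2.
have hdom : {ae P, forall w k, setT w -> (`|(EFin \o h k) w| <= `|(hg w)%:E|)%E}.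
  by apply: aeW => w j _ /=; rewrite lee_fin; exact: c_lip.
have [_ _ cv] := dominated_convergence measurableT mh (measurable_int _ hi) hh
  (integrable_abse hi) hdom.
apply: (cvg_unique _ cv) => //; apply: cvg_near_cst; apply: nearW => k; exact: ih.
Qed.

End Birkhoff.

(** * Expectations over random walk paths *)

Section Tpow.
Context {X : Type} {T Tinv : X -> X} (TK : cancel T Tinv) (TinvK : cancel Tinv T).

Lemma TpowDr1 z w : Tpow T Tinv (z + 1) w = Tpow T Tinv z (T w).
Proof.
case: z => [n|[|n]].
- by rewrite -[Posz n + 1]/(Posz (n + 1)) addn1 /= -iterSr.
- by rewrite -[Negz 0 + 1]/(Posz 0) /= TK.
- rewrite (_ : Negz n.+1 + 1 = Negz n); last by rewrite !NegzE; lia.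
  by rewrite /Tpow [in RHS]iterSr TK.
Qed.

Lemma TpowBr1 z w : Tpow T Tinv (z - 1) w = Tpow T Tinv z (Tinv w).
Proof. by rewrite -[in RHS](subrK 1 z) TpowDr1 TinvK. Qed.

End Tpow.

(** * Walk expectations by recursion and as sums over paths *)

Section Walk.
Context {X : Type} {R : realType} (T Tinv : X -> X) (pp pm : X -> R).
Implicit Types (f g : int -> R).

(** [E_w[f (X_n)]] by conditioning on the first step: the environment is recentred at the new site
    and [f] is translated to compensate. *)
Fixpoint walk_mean (n : nat) f (w : X) : R :=
  if n is m.+1 then
    pp w * walk_mean m (fun x => f (x + 1)) (T w) +
    pm w * walk_mean m (fun x => f (x - 1)) (Tinv w)
  else f 0.

Lemma eq_walk_mean n f g w : f =1 g -> walk_mean n f w = walk_mean n g w.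
Proof. by move=> /funext ->. Qed.

Lemma walk_meanZ n c f w :
  walk_mean n (fun x => c * f x) w = c * walk_mean n f w.
Proof. by elim: n f w => [//|n IH] f w /=; rewrite !IH; ring. Qed.

Lemma walk_meanD n f g w :
  walk_mean n (fun x => f x + g x) w = walk_mean n f w + walk_mean n g w.
Proof. by elim: n f g w => [//|n IH] f g w /=; rewrite !IH; ring. Qed.

Hypothesis TK : cancel T Tinv.
Hypothesis TinvK : cancel Tinv T.

Lemma walk_mean_markov n m f w : walk_mean (n + m) f w =
  walk_mean n (fun x => walk_mean m (fun y => f (x + y)) (Tpow T Tinv x w)) w.
Proof.
elim: n f w => [|n IH] f w.
  by rewrite /=; apply: eq_walk_mean => y; rewrite add0r.
rewrite addSn /= !IH; congr (_ * _ + _ * _); apply: eq_walk_mean => x.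
- by rewrite -(TpowDr1 TK); apply: eq_walk_mean => y; congr f; ring.
- by rewrite -(TpowBr1 TK TinvK); apply: eq_walk_mean => y; congr f; ring.
Qed.

Definition cons_path n (p : bool * {ffun 'I_n -> bool}) : {ffun 'I_n.+1 -> bool} :=
  [ffun i => if unlift ord0 i is Some j then p.2 j else p.1].

Lemma cons_path_bij n : bijective (@cons_path n).
Proof.
exists (fun s : {ffun 'I_n.+1 -> bool} => (s ord0, [ffun j => s (lift ord0 j)])) => [[a s]|s].
- rewrite /cons_path ffunE unlift_none /=; congr pair.
  by apply/ffunP => j; rewrite !ffunE liftK.
- by apply/ffunP => i; rewrite ffunE /=; case: unliftP => [j ->|->]; rewrite ?ffunE.
Qed.

Lemma pos_cons_path n a (s : {ffun 'I_n -> bool}) k :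
  pos (cons_path (a, s)) k.+1 = pos s k + (if a then 1 else -1).
Proof.
rewrite /pos big_mkcond big_ord_recl /= ffunE unlift_none /= addrC; congr (_ + _).
rewrite [RHS]big_mkcond; apply: eq_bigr => i _.
by rewrite ffunE liftK /= /bump /= add1n ltnS.
Qed.

Lemma pos0 n (s : {ffun 'I_n -> bool}) : pos s 0 = 0.
Proof. by rewrite /pos big1. Qed.

(** Ties the recursion to the path sum in [quenched_mgf]; the induction splits off the first step by
    means of [cons_path]. *)
Lemma walk_mean_path n f w : walk_mean n f w =
  \sum_(s : {ffun 'I_n -> bool})
    ((\prod_(k < n) (if s k then pp (Tpow T Tinv (pos s k) w)
                     else pm (Tpow T Tinv (pos s k) w))) * f (pos s n)).
Proof.
elim: n f w => [|n IH] f w.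
  rewrite (eq_bigr (fun=> f 0)) => [|s _]; last by rewrite big_ord0 mul1r pos0.
  by rewrite sumr_const card_ffun card_ord expn0 mulr1n.
rewrite (reindex (@cons_path n)) /=; last exact: onW_bij (cons_path_bij n).
rewrite -(pair_bigA _ (fun a s => (\prod_(k < n.+1)
  (if cons_path (a, s) k then pp (Tpow T Tinv (pos (cons_path (a, s)) k) w)
   else pm (Tpow T Tinv (pos (cons_path (a, s)) k) w)))
   * f (pos (cons_path (a, s)) n.+1))) /=.
rewrite big_bool /= !IH !big_distrr /=; congr (_ + _); apply: eq_bigr => s _.
all: rewrite big_ord_recl /= pos0 ffunE unlift_none /= pos_cons_path mulrA.
all: congr (_ * _ * _); apply: eq_bigr => i _.
all: rewrite ffunE liftK /= /bump /= add1n pos_cons_path.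
all: by rewrite ?(TpowDr1 TK) ?(TpowBr1 TK TinvK).
Qed.

Hypothesis pp0 : forall w, 0 <= pp w.
Hypothesis pm0 : forall w, 0 <= pm w.
Hypothesis pD : forall w, pp w + pm w = 1.

(** After [n] steps the walk is within distance [n] of 0, so [f] and [g] are compared there only. *)
Lemma le_walk_mean n f g w :
  (forall x : int, (`|x| <= n%:Z)%R -> f x <= g x) ->
  walk_mean n f w <= walk_mean n g w.
Proof.
elim: n f g w => [|n IH] f g w fg /=; first exact: fg.
by apply: lerD; apply: ler_wpM2l => //; apply: IH => x xn; apply: fg; lia.
Qed.

Lemma walk_mean_cst n c w : walk_mean n (fun=> c) w = c.
Proof. by elim: n w => [//|n IH] w /=; rewrite !IH -mulrDl pD mul1r. Qed.

Lemma walk_mean_ge0 n f w : (forall x, 0 <= f x) -> 0 <= walk_mean n f w.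
Proof. by move=> f0; rewrite -(walk_mean_cst n 0 w); apply: le_walk_mean. Qed.

End Walk.

(** Swapping the shifts and the step probabilities gives the law of [- X_n]; this transfers results
    about moves to the right to moves to the left. *)
Lemma walk_mean_flip {X : Type} {R : realType} (T Tinv : X -> X) (pp pm : X -> R)
    n f w :
  walk_mean Tinv T pm pp n f w = walk_mean T Tinv pp pm n (fun x => f (- x)) w.
Proof.
elim: n f w => [|n IH] f w /=; first by rewrite oppr0.
by rewrite !IH addrC; congr (_ * _ + _ * _); apply: eq_walk_mean => x;
  rewrite opprD ?opprK.
Qed.

(** * Exponential moments of the walk *)

Section Mgf.
Context {X : Type} {R : realType} (T Tinv : X -> X) (pp pm : X -> R) (lam : R).

Definition mgf n w : R :=
  walk_mean T Tinv pp pm n (fun x => expR (lam * x%:~R)) w.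

(** [E_w[exp (lam X_n); X_n >= 0]]. Ending weakly to the right is what allows such moves to be
    concatenated along the forward orbit. *)
Definition mgf_right n w : R :=
  walk_mean T Tinv pp pm n (fun x => if 0 <= x then expR (lam * x%:~R) else 0) w.

Hypothesis TK : cancel T Tinv.
Hypothesis TinvK : cancel Tinv T.
Hypothesis pp0 : forall w, 0 <= pp w.
Hypothesis pm0 : forall w, 0 <= pm w.
Hypothesis pD : forall w, pp w + pm w = 1.

Lemma quenched_mgfE w n : quenched_mgf T Tinv pp pm w lam n = mgf n w.
Proof. by rewrite /mgf walk_mean_path. Qed.

Lemma mgf0 w : mgf 0 w = 1.
Proof. by rewrite /mgf /= mulr0 expR0. Qed.

Lemma mgfS n w : mgf n.+1 w =
  pp w * expR lam * mgf n (T w) + pm w * expR (- lam) * mgf n (Tinv w).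
Proof.
rewrite /mgf /= -!mulrA -[expR lam * _]walk_meanZ -[expR (- lam) * _]walk_meanZ.
by congr (_ * _ + _ * _); apply: eq_walk_mean => x; rewrite -expRD; congr expR;
  rewrite ?intrD ?intrB; ring.
Qed.

Lemma mgf_ge n w : expR (- (`|lam| * n%:R)) <= mgf n w.
Proof.
rewrite -(walk_mean_cst T Tinv pD n (expR _) w); apply: le_walk_mean => // x xn.
rewrite ler_expR lerNl; apply: le_trans (ler_norm _) _.
rewrite normrN normrM ler_wpM2l// -intr_norm.
by rewrite -[n%:R]/(n%:Z%:~R) ler_int.
Qed.

Lemma mgf_gt0 n w : 0 < mgf n w.
Proof. exact: lt_le_trans (expR_gt0 _) (mgf_ge n w). Qed.

(** Keeps only paths that first step right and then have a displacement [>= 0]. *)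
Lemma mgf_right_step n w :
  pp w * expR lam * mgf_right n (T w) <= mgf_right n.+1 w.
Proof.
rewrite /mgf_right /= -mulrA -[expR lam * _]walk_meanZ.
apply: le_trans (_ : pp w * walk_mean T Tinv pp pm n (fun x =>
  if 0 <= x + 1 then expR (lam * (x + 1)%:~R) else 0) (T w) <= _); last first.
  rewrite lerDl mulr_ge0//; apply: walk_mean_ge0 => // x.
  by case: ifP; rewrite ?expR_ge0.
apply: ler_wpM2l => //; apply: le_walk_mean => // x _.
have [x0|x0] := leP 0 x; last by rewrite mulr0; case: ifP; rewrite ?expR_ge0.
rewrite ifT; last by lia.
by rewrite -expRD ler_expR intrD; lra.
Qed.

(** [exp (lam X_n + phi X_n - q n)] is a supermartingale. The induction conditions on the first step
    and translates [phi] by one. *)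
Lemma mgf_le_expR (F : X -> R) (q : R) (phi : int -> R) (n : nat) (w : X) :
  (forall x, phi (x + 1) - phi x = F (Tpow T Tinv x w)) ->
  (forall x, let v := Tpow T Tinv x w in
     pp v * expR (lam + F v) + pm v * expR (- lam - F (Tinv v)) <= expR q) ->
  walk_mean T Tinv pp pm n (fun x => expR (lam * x%:~R + phi x)) w
    <= expR (q * n%:R + phi 0).
Proof.
elim: n w phi => [|n IH] w phi dphi qle /=; first by rewrite !mulr0.
have dphi0 := dphi 0; rewrite add0r /= in dphi0.
have dphi1 := dphi (-1); rewrite addrC subrr /= in dphi1.
have h1 := IH (T w) (fun x => phi (x + 1)).
have h2 := IH (Tinv w) (fun x => phi (x - 1)).
have {}h1 : walk_mean T Tinv pp pm n (fun x => expR (lam * x%:~R + phi (x + 1)))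
    (T w) <= expR (q * n%:R + phi 1).
  apply: h1 => x; first by rewrite dphi (TpowDr1 TK).
  by rewrite -(TpowDr1 TK); exact: qle.
have {}h2 : walk_mean T Tinv pp pm n (fun x => expR (lam * x%:~R + phi (x - 1)))
    (Tinv w) <= expR (q * n%:R + phi (-1)).
  apply: h2 => x; last by rewrite -(TpowBr1 TK TinvK); exact: qle.
  by rewrite -(TpowBr1 TK TinvK) -dphi; congr (phi _ - phi _); ring.
have := qle 0; rewrite /= => q0.
have -> : walk_mean T Tinv pp pm n
    (fun x => expR (lam * (x + 1)%:~R + phi (x + 1))) (T w) =
  expR lam * walk_mean T Tinv pp pm n
    (fun x => expR (lam * x%:~R + phi (x + 1))) (T w).
  rewrite -walk_meanZ; apply: eq_walk_mean => x.
  by rewrite -expRD intrD; congr expR; ring.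
have -> : walk_mean T Tinv pp pm n
    (fun x => expR (lam * (x - 1)%:~R + phi (x - 1))) (Tinv w) =
  expR (- lam) * walk_mean T Tinv pp pm n
    (fun x => expR (lam * x%:~R + phi (x - 1))) (Tinv w).
  rewrite -walk_meanZ; apply: eq_walk_mean => x.
  by rewrite -expRD intrB; congr expR; ring.
apply: le_trans (_ : pp w * (expR lam * expR (q * n%:R + phi 1)) +
   pm w * (expR (- lam) * expR (q * n%:R + phi (-1))) <= _).
  by apply: lerD; apply: ler_wpM2l => //; apply: ler_wpM2l; rewrite ?expR_ge0.
have -> : q * n.+1%:R + phi 0 = q + (q * n%:R + phi 0) by rewrite -natr1; ring.
rewrite expRD; apply: le_trans (ler_wpM2r (expR_ge0 _) q0).
rewrite mulrDl -!mulrA -!expRD; apply: lerD; apply: ler_wpM2l => //;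
  rewrite ler_expR; lra.
Qed.

(* Strong induction on [m]: from a site with an [n]-step reward, spend [n] steps
   moving weakly to the right; from any other site, take one step to the right at
   cost [b]. Since each step to the right leaves the site for good, every site is
   charged at most once. *)
Lemma mgf_lower (r : R) (N : nat) (b : X -> R) (w : X) (m : nat) :
  (forall v, 0 <= b v) ->
  (forall k, let v := iter k T w in
     (exists2 n, (0 < n <= N)%N & expR (r * n%:R) <= mgf_right n v) \/
     (0 < pp v /\ r - lam - ln (pp v) <= b v)) ->
  expR (r * m%:R - birkhoff_sum T b m w - (`|lam| + `|r|) * N%:R) <= mgf m w.
Proof.
move=> b0.
elim/ltn_ind: m w => m IH w good.
have goodj j k : let v := iter k T (iter j T w) in
     (exists2 n, (0 < n <= N)%N & expR (r * n%:R) <= mgf_right n v) \/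
     (0 < pp v /\ r - lam - ln (pp v) <= b v).
  by rewrite /= -iterD; exact: good.
have S0 := birkhoff_sum_ge0 T m w b0.
have c0 : 0 <= (`|lam| + `|r|) * N%:R by rewrite mulr_ge0// addr_ge0.
case: m IH S0 => [|m] IH S0.
  by rewrite mgf0 -[leRHS]expR0 ler_expR; lra.
have [[n /andP[n0 nN] nr]|[p0 pb]] := good 0%N; last first.
  (* Single step to the right: its factor [pp w * exp lam] is at least [exp (r - b w)], and [b w] is
     the first term of the Birkhoff sum. *)
  rewrite /= in p0 pb; rewrite mgfS.
  apply: le_trans (_ : pp w * expR lam * mgf m (T w) <= _); last first.
    by rewrite lerDl !mulr_ge0 ?expR_ge0// ltW// mgf_gt0.
  have := IH m (ltnSn m) (T w) (goodj 1%N).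
  rewrite birkhoff_sumS => IHm.
  apply: le_trans (ler_wpM2l _ IHm); last by rewrite mulr_ge0 ?expR_ge0.
  rewrite -[X in X * _ * _](@lnK _ (pp w)) ?posrE// -!expRD ler_expR -natr1.
  by lra.
(* If the reward takes longer than the time left, the crude bound ends the recursion; the constant
   [(|lam| + |r|) N] pays for this. *)
have [mn|nm] := ltnP m.+1 n.
  apply: le_trans (mgf_ge _ _); rewrite ler_expR.
  have h1 : m.+1%:R <= N%:R :> R by rewrite ler_nat (leq_trans (ltnW mn)).
  have h2 : r * m.+1%:R <= `|r| * N%:R.
    apply: le_trans (ler_norm _) _; rewrite normrM normr_nat.
    by apply: ler_wpM2l; rewrite ?h1.
  have h3 : `|lam| * m.+1%:R <= `|lam| * N%:R by apply: ler_wpM2l; rewrite ?h1.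
  by rewrite mulrDl; lra.
have -> : mgf m.+1 w = walk_mean T Tinv pp pm n (fun x =>
    expR (lam * x%:~R) * mgf (m.+1 - n) (Tpow T Tinv x w)) w.
  rewrite /mgf -{1}(subnKC nm) (walk_mean_markov _ _ TK TinvK).
  apply: eq_walk_mean => x; rewrite -walk_meanZ; apply: eq_walk_mean => y.
  by rewrite -expRD intrD; congr expR; ring.
set K := r * (m.+1 - n)%:R - birkhoff_sum T b m.+1 w - (`|lam| + `|r|) * N%:R.
apply: le_trans (_ : expR K * mgf_right n w <= _); last first.
  rewrite /mgf_right -walk_meanZ; apply: le_walk_mean => // x xn.
  have [x0|x0] := leP 0 x; last first.
    by rewrite mulr0 mulr_ge0 ?expR_ge0// ltW// mgf_gt0.
  rewrite mulrC; apply: ler_wpM2l; first exact: expR_ge0.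
  case: x x0 xn => // j _ xn.
  (* As [0 <= j <= n], the remaining charges lie in [[j, j + m.+1 - n)], which is inside
     [[0, m.+1)]. *)
  have jn : (j <= n)%N by rewrite -lez_nat; move: xn; rewrite ger0_norm.
  have lt : (m.+1 - n < m.+1)%N by rewrite ltn_subrL n0.
  apply: le_trans (IH _ lt (iter j T w) (goodj j)).
  rewrite ler_expR /K.
  have : birkhoff_sum T b (m.+1 - n) (iter j T w) <= birkhoff_sum T b m.+1 w.
    by apply: birkhoff_sum_le => //; lia.
  by lra.
apply: le_trans (ler_wpM2l (expR_ge0 _) nr).
rewrite -expRD ler_expR /K natrB//; lra.
Qed.

End Mgf.

(** * Reversal of the walk *)

Section MgfFlip.
Context {X : Type} {R : realType} (T Tinv : X -> X) (pp pm : X -> R) (lam : R).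

Lemma mgf_flip n w : mgf Tinv T pm pp (- lam) n w = mgf T Tinv pp pm lam n w.
Proof.
rewrite /mgf walk_mean_flip; apply: eq_walk_mean => x.
by rewrite intrN mulrNN.
Qed.

Hypothesis pp0 : forall w, 0 <= pp w.
Hypothesis pm0 : forall w, 0 <= pm w.

(** Splits by the sign of [X_n]; the event [X_n = 0] is counted twice. *)
Lemma mgf_le_right_left n w : mgf T Tinv pp pm lam n w <=
  mgf_right T Tinv pp pm lam n w + mgf_right Tinv T pm pp (- lam) n w.
Proof.
rewrite /mgf /mgf_right [X in _ + X]walk_mean_flip -walk_meanD; apply: le_walk_mean => // x _.
rewrite intrN mulrNN; have [x0|x0] := leP 0 x.
  by rewrite lerDl; case: ifP; rewrite ?expR_ge0.
by rewrite add0r ifT// oppr_ge0 ltW.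
Qed.

End MgfFlip.

(** * Almost sure bounds on the growth rate *)

Section RandomEnvironment.
Context {d} {X : measurableType d} {R : realType} {P : probability X R}.

(** The function [f - e] has negative integral, so its Birkhoff sums are bounded above. *)
Lemma birkhoff_sum_le_linear (T Tinv : X -> X) (f : X -> R) (e : R) :
  ergodic_automorphism P T Tinv -> P.-integrable setT (EFin \o f) ->
  (\int[P]_w (f w)%:E < e%:E)%E ->
  {ae P, forall w, exists C, forall n, birkhoff_sum T f n w <= e * n%:R + C}.
Proof.
move=> ET fi fe.
have ce : P.-integrable setT (EFin \o cst e) by exact: finite_measure_integrable_cst.
have gi : P.-integrable setT (EFin \o (fun w => f w - e)).
  exact: (integrableB measurableT fi ce).
have g0 : (\int[P]_w (f w - e)%:E < 0)%E.
  under eq_integral do rewrite EFinB.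
  rewrite (integralB_EFin measurableT fi ce) /= integral_cst//.
  rewrite [X in (_ * X)%E](_ : _ = 1%E) ?mule1; last exact: probability_setT.
  by rewrite lteBlDr// add0e.
have := birkhoff_sum_bounded ET gi g0; apply: filterS => w [C hC]; exists C => n.
have := hC n; rewrite /birkhoff_sum sumrB sumr_const card_ord -mulr_natr; lra.
Qed.

Variables (T Tinv : X -> X) (pp pm : X -> R) (lam : R).
Hypothesis ET : ergodic_automorphism P T Tinv.
Hypothesis mpp : measurable_fun setT pp.
Hypothesis mpm : measurable_fun setT pm.
Hypothesis pp0 : forall w, 0 <= pp w.
Hypothesis pm0 : forall w, 0 <= pm w.
Hypothesis pD : forall w, pp w + pm w = 1.

Let TK := ea_can ET.
Let TinvK := ea_canV ET.

Lemma measurable_walk_mean n f :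
  measurable_fun setT (walk_mean T Tinv pp pm n f).
Proof.
elim: n f => [|n IH] f /=; first exact: measurable_cst.
apply: measurable_funD; apply: measurable_funM => //.
- exact: measurableT_comp (IH _) (ea_meas ET).
- exact: measurableT_comp (IH _) (ea_measV ET).
Qed.

(** One of the two probabilities is positive. As [ln] is 0 on nonpositive reals, positivity is what
    allows [ln] to be inverted. *)
Lemma step_weight_gt0 w (x y : R) : 0 < pp w * expR x + pm w * expR y.
Proof.
have := expR_gt0 x; have := expR_gt0 y; have := pp0 w; have := pm0 w.
have := pD w; set a := expR x; set b := expR y; move=> e m0 p0 b0 a0.
have [p1|p1] := ltP 0 (pp w).
  by rewrite ltr_wpDr ?mulr_gt0 ?mulr_ge0// ltW.
by rewrite ltr_wpDl ?mulr_gt0 ?mulr_ge0//; lra.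
Qed.

(** The increments of [phi] have mean 0, so [phi >= - e n - C] on [[-n, n]], and removing [phi] from
    the supermartingale bound costs at most [exp (e n + C)]. *)
Lemma ln_mgf_upper (Fp Fm : X -> R) (q e : R) :
  classK P T Fp Fm ->
  {ae P, forall w, ln (pp w * expR (lam + Fp w) + pm w * expR (- lam + Fm w)) <= q} ->
  0 < e ->
  {ae P, forall w, exists C, forall n : nat,
     ln (mgf T Tinv pp pm lam n w) <= (q + e) * n%:R + C}.
Proof.
case=> iFp iFm Fp0 _ FK aq e0.
have EV := ergodic_automorphismV ET.
have iNFp : P.-integrable setT (EFin \o (fun w => - Fp w)).
  by have := integrableN iFp.
(* Lower bounds on [phi] are upper bounds on sums of [- Fp] along the forward orbit and of
   [Fp \o Tinv] along the backward orbit. *)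
have bp : {ae P, forall w, exists C, forall n,
    birkhoff_sum T (fun w => - Fp w) n w <= e * n%:R + C}.
  apply: (birkhoff_sum_le_linear ET iNFp).
  under eq_integral do rewrite EFinN.
  rewrite integralN ?Fp0 ?oppe0 ?lte_fin//.
  exact: integrable_add_def.
have bm : {ae P, forall w, exists C, forall n,
    birkhoff_sum Tinv (Fp \o Tinv) n w <= e * n%:R + C}.
  apply: (birkhoff_sum_le_linear EV (integrable_comp EV iFp)).
  by rewrite (integral_comp EV iFp) Fp0 lte_fin.
have aQ := ae_orbit ET (Q := fun v =>
  ln (pp v * expR (lam + Fp v) + pm v * expR (- lam + Fm v)) <= q) aq.
have aK := ae_orbit ET (Q := fun v => Fp (Tinv v) + Fm (T (Tinv v)) = 0)
  (ae_comp EV (Q := fun v => Fp v + Fm (T v) = 0) FK).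
have aQK := ae_and aQ aK; have aB := ae_and bp bm.
move: aQK aB; apply: filterS2 => w [Q K] [[Cp hp] [Cm hm]].
exists (`|Cp| + `|Cm|) => n.
(* [Negz k] is [-(k+1)], so that sum runs over the sites [-1, ..., -(k+1)]. *)
pose phi (z : int) := match z with
  | Posz k => birkhoff_sum T Fp k w
  | Negz k => - birkhoff_sum Tinv (Fp \o Tinv) k.+1 w end.
have sumSr (S : X -> X) (F : X -> R) k :
    birkhoff_sum S F k.+1 w = birkhoff_sum S F k w + F (iter k S w).
  by rewrite /birkhoff_sum big_ord_recr.
have dphi x : phi (x + 1) - phi x = Fp (Tpow T Tinv x w).
  case: x => [k|[|k]].
  - by rewrite -[Posz k + 1]/(Posz (k + 1)) addn1 /phi sumSr addrC addKr.
  - by rewrite -[Negz 0 + 1]/(Posz 0) /phi /birkhoff_sum big_ord0 big_ord1 /= sub0r opprK.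
  - rewrite (_ : Negz k.+1 + 1 = Negz k); last by rewrite !NegzE; lia.
    by rewrite /phi [in X in _ - X]sumSr /=; lra.
have qle x : let v := Tpow T Tinv x w in
    pp v * expR (lam + Fp v) + pm v * expR (- lam - Fp (Tinv v)) <= expR q.
  move=> v; have h1 := Q x; have h2 := K x; rewrite /= -/v TinvK in h1 h2.
  have -> : - lam - Fp (Tinv v) = - lam + Fm v by lra.
  rewrite -[leLHS]lnK; last by rewrite posrE; exact: step_weight_gt0.
  by rewrite ler_expR.
have := mgf_le_expR TK TinvK pp0 pm0 n dphi qle.
have -> : phi 0 = 0 by rewrite -[phi 0]/(birkhoff_sum T Fp 0 w) /birkhoff_sum big_ord0.
rewrite addr0 => up.
have phi_ge x : (`|x| <= n%:Z)%R -> - (e * n%:R + (`|Cp| + `|Cm|)) <= phi x.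
  have Cp1 := ler_norm Cp; have Cm1 := ler_norm Cm.
  have Cp0 := normr_ge0 Cp; have Cm0 := normr_ge0 Cm.
  have le_n k : (k <= n)%N -> e * k%:R <= e * n%:R by move=> kn; rewrite ler_pM2l// ler_nat.
  case: x => k /= kn.
  - have := le_n k; have := hp k; rewrite /birkhoff_sum sumrN.
    by rewrite -/(birkhoff_sum T Fp k w) => + /(_ kn); lra.
  - by have := hm k.+1; have := le_n k.+1; rewrite /phi => /(_ kn); lra.
rewrite -ler_expR lnK ?posrE ?mgf_gt0//.
have -> : (q + e) * n%:R + (`|Cp| + `|Cm|)
  = (e * n%:R + (`|Cp| + `|Cm|)) + q * n%:R by ring.
rewrite expRD; apply: le_trans (ler_wpM2l (expR_ge0 _) up).
rewrite -walk_meanZ; apply: le_walk_mean => // x xn.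
by rewrite -expRD ler_expR; have := phi_ge x xn; lra.
Qed.

(** [elog] is [-oo] where [p] is not positive, and integrable functions are almost everywhere
    finite. *)
Lemma elog_gt0 (p : X -> R) : P.-integrable setT (fun w => elog (p w)) ->
  {ae P, forall w, 0 < p w}.
Proof.
move=> ip; have := integrable_ae measurableT ip; apply: filterS => w /(_ I).
by rewrite /elog; case: ifP.
Qed.

(** [ln] agrees with [elog] where [p > 0] and is 0 elsewhere. *)
Lemma integrable_ln (p : X -> R) : measurable_fun setT p ->
  P.-integrable setT (fun w => elog (p w)) ->
  P.-integrable setT (EFin \o (fun w => ln (p w))).
Proof.
move=> mp ip; apply: le_integrable ip => //.
  by apply/measurable_EFinP; exact: (measurableT_comp (@measurable_ln R) mp).
by move=> w _ /=; rewrite /elog; case: ifP => //=; rewrite leey.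
Qed.

Hypothesis ipp : P.-integrable setT (fun w => elog (pp w)).

(** [b N] charges [B] at sites with no reward within [N] steps. It tends to 0 almost surely and is
    dominated by [B], so some [N] makes its integral less than [e]; the charges then grow at rate at
    most [e]. *)
Lemma ln_mgf_lower (r e : R) :
  {ae P, forall w, exists2 n, (0 < n)%N &
     expR (r * n%:R) <= mgf_right T Tinv pp pm lam n w} ->
  0 < e ->
  {ae P, forall w, exists C, forall n : nat,
     (r - e) * n%:R - C <= ln (mgf T Tinv pp pm lam n w)}.
Proof.
move=> good e0.
(* Integrable bound for the cost [r - lam - ln (pp w)] of one step to the right. *)
pose B (w : X) : R := `|ln (pp w)| + (`|lam| + `|r|).
have iB : P.-integrable setT (EFin \o B).
  have iln := integrable_norm (integrable_ln mpp ipp).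
  have ic : P.-integrable setT (EFin \o cst (`|lam| + `|r|)).
    exact: finite_measure_integrable_cst.
  exact: (integrableD measurableT iln ic).
pose A N := \bigcup_(n in [set n | (0 < n <= N)%N])
  [set w | expR (r * n%:R) <= mgf_right T Tinv pp pm lam n w].
have mA N : measurable (A N).
  apply: bigcup_measurable => n _; rewrite -[X in measurable X]setTI.
  have := @measurable_walk_mean n (fun x => if 0 <= x then expR (lam * x%:~R) else 0)
    measurableT _ (measurable_itv `[expR (r * n%:R), +oo[).
  by congr measurable; apply/seteqP; split=> w /=; rewrite in_itv /= andbT.
pose b N w : R := B w * \1_(~` A N) w.
have mb N : measurable_fun setT (b N).
  apply: measurable_funM; first exact: integrable_measurable iB.
  by apply: measurable_indic; exact: measurableC.
have B0 w : 0 <= B w by rewrite !addr_ge0.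
have b0 N w : 0 <= b N w by rewrite mulr_ge0.
have bB N w : b N w <= B w.
  by rewrite ler_piMr// indicE; case: (_ \in _).
have ib N : P.-integrable setT (EFin \o b N).
  apply: le_integrable iB => //; first exact/measurable_EFinP.
  by move=> w _ /=; rewrite lee_fin !ger0_norm.
have cvb : {ae P, forall w, setT w -> (EFin \o b N) w @[N --> \oo] --> (cst 0%E w : \bar R)}.
  move: good; apply: filterS => w [n n0 hn] _; apply: cvg_near_cst.
  exists n => // N /= nN; rewrite /b indicE memNset ?mulr0//.
  by move=> /= nA; apply: nA; exists n => //=; rewrite n0.
have dom : {ae P, forall w N, setT w -> (`|(EFin \o b N) w| <= (EFin \o B) w)%E}.
  by apply: aeW => w N _ /=; rewrite lee_fin ger0_norm.
have [_ _ cv] := dominated_convergence measurableT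
  (fun N => measurable_int _ (ib N)) (measurable_cst _) cvb iB dom.
rewrite integral0 in cv.
have [N hN] : exists N, (\int[P]_w (b N w)%:E < e%:E)%E.
  apply: contrapT => nN; have : (e%:E <= 0 :> \bar R)%E.
    apply: cvge_ge cv; apply: nearW => N; rewrite leNgt; apply/negP => h.
    by apply: nN; exists N.
  by rewrite lee_fin leNgt e0.
have bk := birkhoff_sum_le_linear ET (ib N) hN.
move: bk (ae_iter ET (elog_gt0 ipp)); apply: filterS2 => w [C hC] ppos.
exists (C + (`|lam| + `|r|) * N%:R) => n.
have alt k : let v := iter k T w in
  (exists2 n, (0 < n <= N)%N & expR (r * n%:R) <= mgf_right T Tinv pp pm lam n v) \/
     (0 < pp v /\ r - lam - ln (pp v) <= b N v).
  move=> v; have [[j jN hj]|nA] := pselect (A N v); first by left; exists j.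
  right; split; first exact: ppos.
  rewrite /b indicE mem_set// mulr1 /B.
  have := ler_norm r; have := ler_norm (- lam); have := ler_norm (- ln (pp v)).
  by rewrite !normrN; lra.
have := mgf_lower TK TinvK pp0 pm0 pD n (b0 N) alt.
rewrite -[X in _ <= X -> _]lnK ?posrE ?mgf_gt0// ler_expR.
by have := hC n; lra.
Qed.

End RandomEnvironment.

(** * The Green function *)

Section Green.
Context {d} {X : measurableType d} {R : realType} {P : probability X R}.
Variables (T Tinv : X -> X) (pp pm : X -> R) (lam : R).
Hypothesis ET : ergodic_automorphism P T Tinv.
Hypothesis mpp : measurable_fun setT pp.
Hypothesis mpm : measurable_fun setT pm.
Hypothesis pp0 : forall w, 0 <= pp w.
Hypothesis pm0 : forall w, 0 <= pm w.
Hypothesis pD : forall w, pp w + pm w = 1.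
Hypothesis ipp : P.-integrable setT (fun w => elog (pp w)).
Hypothesis ipm : P.-integrable setT (fun w => elog (pm w)).

(** Valued in [\bar R] because its finiteness is the criterion that separates the two cases of the
    lower bound. *)
Definition green (r : R) (w : X) : \bar R :=
  (\sum_(n <oo) (expR (- r * n%:R) * mgf T Tinv pp pm lam n w)%:E)%E.

Let term_ge0 r n w : (0 <= (expR (- r * n%:R) * mgf T Tinv pp pm lam n w)%:E)%E.
Proof. by rewrite lee_fin mulr_ge0 ?expR_ge0// ltW// mgf_gt0. Qed.

Lemma measurable_green r : measurable_fun setT (green r).
Proof.
apply: ge0_emeasurable_sum => [n w _ _|n _]; first exact: term_ge0.
apply/measurable_EFinP; apply: measurable_funM => //.
exact: measurable_walk_mean ET mpp mpm _ _.
Qed.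

Lemma green_ge0 r w : (0 <= green r w)%E.
Proof. by apply: nneseries_ge0 => n _ _; exact: term_ge0. Qed.

(** Conditions on the first step; the 1 is the term at time 0. *)
Lemma greenE r w : green r w =
  (1 + (expR (- r) * (pp w * expR lam))%:E * green r (T w)
     + (expR (- r) * (pm w * expR (- lam)))%:E * green r (Tinv w))%E.
Proof.
rewrite {1}/green nneseries_recl//.
rewrite mulr0 expR0 mul1r mgf0 -addeA; congr (_ + _)%E.
rewrite -(nneseries_addn 1); last by move=> n; exact: term_ge0.
rewrite -!nneseriesZl; [|by move=> n _; exact: term_ge0..].
rewrite -nneseriesD; last 2 first.
- move=> n _ _; apply: mule_ge0; last exact: term_ge0.
  by rewrite lee_fin !mulr_ge0 ?expR_ge0.
- move=> n _ _; apply: mule_ge0; last exact: term_ge0.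
  by rewrite lee_fin !mulr_ge0 ?expR_ge0.
apply: eq_eseriesr => n _; rewrite addn1 -!EFinM -EFinD mgfS; congr (_%:E).
have -> : - r * n.+1%:R = - r + - r * n%:R by rewrite -natr1; ring.
by rewrite expRD; ring.
Qed.

(* [F+ = log G o T - log G] and [F- = log G o T^-1 - log G], for the Green
   function [G], satisfy [p+ e^(lam + F+) + p- e^(- lam + F-) = e^r (1 - 1 / G)]. *)
Lemma Lambda_le_green (r : R) :
  {ae P, forall w, (green r w < +oo)%E} -> (Lambda P T pp pm lam <= r%:E)%E.
Proof.
move=> aG.
have TK := ea_can ET; have TinvK := ea_canV ET.
have EV := ergodic_automorphismV ET.
pose G w : R := fine (green r w).
have GE w : (green r w < +oo)%E -> green r w = (G w)%:E.
  by move=> h; rewrite fineK// ge0_fin_numE// green_ge0.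
pose g w : R := ln (G w).
have mg : measurable_fun setT g.
  apply: measurableT_comp (@measurable_ln R) _.
  exact: measurableT_comp (@fine_measurable R setT measurableT) (measurable_green r).
pose Fp w := g (T w) - g w.
pose Fm w := g (Tinv w) - g w.
have aeGG : {ae P, forall w, pp w * expR (lam + Fp w) + pm w * expR (- lam + Fm w)
    <= expR r}.
  have aTG := ae_and (ae_comp ET (Q := fun w => (green r w < +oo)%E) aG)
    (ae_comp EV (Q := fun w => (green r w < +oo)%E) aG).
  move: aG aTG; apply: filterS2 => w fG [fGT fGTi].
  have e : G w = 1 + expR (- r) * (pp w * expR lam) * G (T w)
      + expR (- r) * (pm w * expR (- lam)) * G (Tinv w).
    apply: EFin_inj; rewrite -(GE _ fG) greenE (GE _ fGT) (GE _ fGTi).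
    by rewrite 2!EFinD !EFinM.
  have Gge1 v : (green r v < +oo)%E -> 1 <= G v.
    move=> fv; rewrite -lee_fin -GE// greenE -addeA leeDl//.
    by rewrite adde_ge0// mule_ge0 ?green_ge0// lee_fin !mulr_ge0 ?expR_ge0.
  have G0 v : (green r v < +oo)%E -> 0 < G v.
    by move=> /Gge1; apply: lt_le_trans.
  rewrite /Fp /Fm /g !addrA !(expRD _ (- ln _)) !(expRD _ (ln _)) expRN.
  rewrite !lnK ?posrE ?G0// !mulrA -mulrDl ler_pdivrMr ?G0//.
  have -> : expR r * G w = expR r + (expR r * expR (- r)) *
     (pp w * expR lam * G (T w) + pm w * expR (- lam) * G (Tinv w)).
    by rewrite e; ring.
  by rewrite -expRD subrr expR0 mul1r lerDr expR_ge0.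
have iFp : P.-integrable setT (EFin \o Fp).
  (* [aeGG] at [w] bounds [Fp w] above through [pp w]; at [T w], where [Fm (T w) = - Fp w], it
     bounds [Fp w] below through [pm (T w)]. *)
  pose D w : R := (2 * `|r| + 2 * `|lam|) + (`|ln (pp w)| + `|ln (pm (T w))|).
  have iD : P.-integrable setT (EFin \o D).
    have ic : P.-integrable setT (EFin \o cst (2 * `|r| + 2 * `|lam|)).
      exact: finite_measure_integrable_cst.
    have i1 := integrable_norm (integrable_ln mpp ipp).
    have i2 := integrable_comp ET (integrable_norm (integrable_ln mpm ipm)).
    exact: (integrableD measurableT ic (integrableD measurableT i1 i2)).
  have mFp : measurable_fun setT Fp.
    by apply: measurable_funB => //; exact: measurableT_comp mg (ea_meas ET).
  apply/integrableP; split; first exact/measurable_EFinP.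
  have /integrableP[mD] := iD; apply: le_lt_trans.
  apply: ae_ge0_le_integral => //.
  - by apply: measurableT_comp => //; exact/measurable_EFinP.
  - by apply: measurableT_comp => //.
  have ap := ae_and (elog_gt0 ipp) (ae_comp ET (Q := fun w => 0 < pm w) (elog_gt0 ipm)).
  have aB := ae_and aeGG (ae_comp ET (Q := fun w => pp w * expR (lam + Fp w)
    + pm w * expR (- lam + Fm w) <= expR r) aeGG).
  move: ap aB; apply: filterS2 => w [p0 m0] [h1 h2] _ /=; rewrite lee_fin.
  rewrite [leRHS]ger0_norm; last by rewrite /D !addr_ge0 ?mulr_ge0.
  have {}h1 : ln (pp w) + (lam + Fp w) <= r.
    rewrite -ler_expR expRD lnK ?posrE//; apply: le_trans h1.
    by rewrite lerDl mulr_ge0 ?expR_ge0.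
  have {}h2 : ln (pm (T w)) + (- lam + Fm (T w)) <= r.
    rewrite -ler_expR expRD lnK ?posrE//; apply: le_trans h2.
    by rewrite lerDr mulr_ge0 ?expR_ge0.
  rewrite /Fm TK in h2.
  have := ler_norm r; have := ler_norm lam; have := ler_norm (- lam).
  have := ler_norm (- ln (pp w)); have := ler_norm (- ln (pm (T w))).
  have := normr_ge0 r; have := normr_ge0 lam.
  have := normr_ge0 (ln (pp w)); have := normr_ge0 (ln (pm (T w))).
  rewrite !normrN ler_norml /D /Fp; rewrite /Fp in h1.
  by move=> *; apply/andP; split; lra.
(* [g] is not known to be integrable, so its two terms cannot be integrated separately. *)
have Fp0 : (\int[P]_w (Fp w)%:E = 0)%E by exact: (integral_coboundary ET mg iFp).
have FmE : Fm = (fun w => - (Fp \o Tinv) w).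
  by apply/funext => w; rewrite /Fm /Fp /= TinvK opprB.
have iFV := integrable_comp EV iFp.
have iFm : P.-integrable setT (EFin \o Fm).
  by rewrite FmE; have := integrableN iFV.
have Fm0 : (\int[P]_w (Fm w)%:E = 0)%E.
  rewrite FmE; under eq_integral do rewrite EFinN.
  rewrite integralN; first by rewrite (integral_comp EV iFp) Fp0 oppe0.
  exact: integrable_add_def.
apply: ereal_inf_le; exists (ess_sup P (fun w => (ln (pp w * expR (lam + Fp w)
                                  + pm w * expR (- lam + Fm w)))%:E)).
  exists Fp, Fm; split=> //; split=> //.
  by apply: aeW => w; rewrite /Fp /Fm TK; ring.
apply/ess_supP; move: aeGG; apply: filterS => w h; rewrite lee_fin.
rewrite -[r in leRHS]expRK ler_ln ?posrE ?expR_gt0//.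
exact: step_weight_gt0.
Qed.

(** Comparison with a geometric series of ratio [exp (s - r) < 1]. *)
Lemma green_lty (s r K : R) w : s < r ->
  (forall n, mgf T Tinv pp pm lam n w <= K * expR (s * n%:R)) ->
  (green r w < +oo)%E.
Proof.
move=> sr le_K; set z := expR (s - r).
have z0 : 0 <= z by rewrite expR_ge0.
have z1 : z < 1 by rewrite -expR0 ltr_expR subr_lt0.
have K0 : 0 <= K.
  have := le_K 0%N; rewrite mgf0 mulr0 expR0 mulr1; lra.
apply: le_lt_trans (ltry (K / (1 - z))).
apply: lime_le; first by apply: is_cvg_nneseries => n _ _; exact: term_ge0.
apply: nearW => n; rewrite sumEFin lee_fin.
apply: le_trans (_ : series (geometric K z) n <= _).
  apply: ler_sum => i _ /=; rewrite /z -expRM_natr.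
  apply: le_trans (ler_wpM2l (expR_ge0 _) (le_K i)) _.
  by rewrite mulrCA -expRD ler_wpM2l// ler_expR; lra.
rewrite geometric_seriesE ?lt_eqF//=; apply: ler_wpM2r.
  by rewrite invr_ge0 subr_ge0 ltW.
by rewrite ler_piMr// gerBl exprn_ge0.
Qed.

(** The set where [mgf_right n / exp (s n)] is unbounded obeys the zero-one law, since a step to the
    right carries unboundedness from [T w] to [w]. *)
Lemma mgf_right_zero_one (s : R) :
  {ae P, forall w, exists2 n, (0 < n)%N &
     expR (s * n%:R) <= mgf_right T Tinv pp pm lam n w} \/
  {ae P, forall w, exists K, forall n,
     mgf_right T Tinv pp pm lam n w <= K * expR (s * n%:R)}.
Proof.
pose A := \bigcap_(k in [set: nat]) \bigcup_(n in [set: nat])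
  [set w | k%:R * expR (s * n%:R) < mgf_right T Tinv pp pm lam n w].
have mA : measurable A.
  apply: bigcap_measurable; first by exists 0%N.
  move=> k _; apply: bigcup_measurable => n _; rewrite -[X in measurable X]setTI.
  have := @measurable_walk_mean _ _ _ _ T Tinv pp pm ET mpp mpm n
    (fun x => if 0 <= x then expR (lam * x%:~R) else 0)
    measurableT _ (measurable_itv `]k%:R * expR (s * n%:R), +oo[).
  by congr measurable; apply/seteqP; split=> w /=; rewrite in_itv /= andbT.
have TA : {ae P, forall w, A (T w) -> A w}.
  have := elog_gt0 ipp; apply: filterS => w p0 AT k _.
  (* Factor kept by the extra step: level [k / c] at [T w] gives level [k] at [w]. *)
  set c := pp w * expR lam * expR (- s).
  have c0 : 0 < c by rewrite !mulr_gt0 ?expR_gt0.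
  have [n _ /= hn] := AT (Num.truncn (k%:R / c)).+1 I.
  exists n.+1 => //=; apply: lt_le_trans (mgf_right_step _ _ _ pp0 pm0 pD n w).
  have h1 : k%:R / c < (Num.truncn (k%:R / c)).+1%:R by exact: truncnS_gt.
  have h2 : k%:R / c * expR (s * n%:R) < mgf_right T Tinv pp pm lam n (T w).
    by apply: lt_trans hn; rewrite ltr_pM2r ?expR_gt0.
  have -> : k%:R * expR (s * n.+1%:R) =
     pp w * expR lam * (k%:R / c * expR (s * n%:R)).
    have -> : s * n.+1%:R = s + s * n%:R by rewrite -natr1; ring.
    rewrite expRD /c expRN; field.
    by rewrite !gt_eqF ?expR_gt0.
  by rewrite ltr_pM2l ?mulr_gt0 ?expR_gt0.
have [aA|anA] := ergodic_zero_one ET mA TA; [left|right].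
(* The inequality at level 1 is strict, which rules out [n = 0], where both sides are 1. *)
- move: aA; apply: filterS => w /(_ 1%N I)[n _ /=]; rewrite mul1r => h.
  exists n; last exact: ltW.
  by case: n h => //; rewrite /mgf_right /= !mulr0 expR0 ltxx.
- move: anA; apply: filterS => w nA; apply: contrapT => nK; apply: nA => k _.
  apply: contrapT => nk; apply: nK; exists k%:R => n.
  by rewrite leNgt; apply/negP => h; apply: nk; exists n.
Qed.

End Green.

(** * Existence and value of the growth rate *)

Section Rates.
Context {R : realType}.

Lemma near_rate_le (x : nat -> R) (a q C : R) : a < q ->
  (forall n, x n <= a * n%:R + C) -> \forall n \near \oo, n%:R^-1 * x n <= q.
Proof.
move=> aq xle; near=> n.
have n0 : 0 < n%:R :> R by rewrite ltr0n; near: n; exact: nbhs_infty_gt.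
rewrite mulrC ler_pdivrMr//; apply: le_trans (xle n) _.
have : C / (q - a) <= n%:R by near: n; exact: nbhs_infty_ger.
by rewrite ler_pdivrMr ?subr_gt0//; lra.
Unshelve. all: by end_near. Qed.

Lemma near_rate_ge (x : nat -> R) (a q C : R) : q < a ->
  (forall n, a * n%:R - C <= x n) -> \forall n \near \oo, q <= n%:R^-1 * x n.
Proof.
move=> qa lex.
have : \forall n \near \oo, n%:R^-1 * - x n <= - q.
  apply: (@near_rate_le (fun n => - x n) (- a) _ C) => [|n]; first by rewrite ltrN2.
  by have := lex n; lra.
by apply: filterS => n; rewrite mulrN lerN2.
Qed.

(** Rational thresholds are countable, so the almost sure bounds hold for all of them at once. *)
Lemma cvg_ereal_rat (v : nat -> R) (L : \bar R) :
  (forall q : rat, (L < (ratr q)%:E)%E -> \forall n \near \oo, v n <= ratr q) ->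
  (forall q : rat, ((ratr q)%:E < L)%E -> \forall n \near \oo, ratr q <= v n) ->
  (fun n => (v n)%:E) @ \oo --> L.
Proof.
case: L => [l||] up lo.
- apply: cvg_EFin; first exact: nearW.
  apply/cvgrPdist_le => e e0.
  have [q1] := @rat_in_itvoo R l (l + e) (ltac:(by rewrite ltrDl)).
  rewrite in_itv /= => /andP[l1 h1].
  have [q2] := @rat_in_itvoo R (l - e) l (ltac:(by rewrite ltrBlDr ltrDl)).
  rewrite in_itv /= => /andP[l2 h2].
  have := up q1; rewrite lte_fin => /(_ l1) U.
  have := lo q2; rewrite lte_fin => /(_ h2) D.
  move: U D; apply: filterS2 => n U D; rewrite /= ler_distl.
  by apply/andP; split; lra.
- apply/cvgeyPge => A.
  have [q] := @rat_in_itvoo R A (A + 1) (ltac:(by rewrite ltrDl)).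
  rewrite in_itv /= => /andP[h _]; have := lo q (ltry _); apply: filterS => n.
  by rewrite lee_fin; apply: le_trans; exact: ltW.
- apply/cvgeNyPle => A.
  have [q] := @rat_in_itvoo R (A - 1) A (ltac:(by rewrite ltrBlDr ltrDl)).
  rewrite in_itv /= => /andP[_ h]; have := up q (ltNyr _); apply: filterS => n.
  by rewrite lee_fin => /le_trans; apply; exact: ltW.
Qed.

Lemma lte_real_between (x : \bar R) (q : R) : (x < q%:E)%E ->
  exists2 a : R, (x <= a%:E)%E & a < q.
Proof.
case: x => [x| |] //= h; first by exists x.
by exists (q - 1); rewrite ?leNye// ltrBlDr ltrDl.
Qed.

End Rates.

(** * The two bounds on the growth rate *)

Section Limit.
Context {d} {X : measurableType d} {R : realType} {P : probability X R}.
Variables (T Tinv : X -> X) (pp pm : X -> R) (lam : R).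
Hypothesis ET : ergodic_automorphism P T Tinv.
Hypothesis mpp : measurable_fun setT pp.
Hypothesis mpm : measurable_fun setT pm.
Hypothesis pp0 : forall w, 0 <= pp w.
Hypothesis pm0 : forall w, 0 <= pm w.
Hypothesis pD : forall w, pp w + pm w = 1.
Hypothesis ipp : P.-integrable setT (fun w => elog (pp w)).
Hypothesis ipm : P.-integrable setT (fun w => elog (pm w)).

Lemma rate_le_Lambda (q : R) : (Lambda P T pp pm lam < q%:E)%E ->
  {ae P, forall w, \forall n \near \oo,
     n%:R^-1 * ln (mgf T Tinv pp pm lam n w) <= q}.
Proof.
case/ereal_inf_lt => _ [Fp [Fm [FK ->]]] /lte_real_between[a /ess_supP ha aq].
(* Half of the gap, so that [a + e < q]. *)
have e0 : 0 < (q - a) / 2 by lra.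
have ha' : {ae P, forall w, ln (pp w * expR (lam + Fp w)
  + pm w * expR (- lam + Fm w)) <= a} by [].
have := ln_mgf_upper ET pp0 pm0 pD FK ha' e0; apply: filterS => w [C hC].
by apply: (near_rate_le _ hC); lra.
Qed.

Lemma Lambda_le_rate (q : R) : (q%:E < Lambda P T pp pm lam)%E ->
  {ae P, forall w, \forall n \near \oo,
     q <= n%:R^-1 * ln (mgf T Tinv pp pm lam n w)}.
Proof.
move=> qL.
have [a qa aL] : exists2 a : R, q < a & (a%:E <= Lambda P T pp pm lam)%E.
  case: (Lambda P T pp pm lam) qL => [l||] //= h; first by exists l.
  by exists (q + 1); rewrite ?leey// ltrDl.
(* Equally spaced [q < s < r < a]: [s] is the rate tried by the strategies, still above [q] after a
   loss of [(s - q) / 2], and [r] is the discount rate of the Green function. *)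
pose s := (2 * q + a) / 3; pose r := (q + 2 * a) / 3.
have sr : s < r by rewrite /s /r; lra.
have e0 : 0 < (s - q) / 2 by rewrite /s; lra.
have EV := ergodic_automorphismV ET.
have pD' w : pm w + pp w = 1 by rewrite addrC.
case: (mgf_right_zero_one lam ET mpp mpm pp0 pm0 pD ipp s) => [good|bR].
  have := ln_mgf_lower ET mpp mpm pp0 pm0 pD ipp good e0.
  by apply: filterS => w [C hC]; apply: (near_rate_ge _ hC); lra.
case: (mgf_right_zero_one (- lam) EV mpm mpp pm0 pp0 pD' ipm s) => [good|bL].
  have := ln_mgf_lower EV mpm mpp pm0 pp0 pD' ipm good e0.
  apply: filterS => w [C hC]; apply: (@near_rate_ge _ _ (s - (s - q) / 2) _ C).
    by lra.
  by move=> n; rewrite -mgf_flip; exact: hC.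
(* Both one-sided moments are [O(exp (s n))], so the Green function is finite and [Lambda <= r < a],
   a contradiction. *)
exfalso; have : (Lambda P T pp pm lam <= r%:E)%E.
  apply: (Lambda_le_green ET mpp mpm pp0 pm0 pD ipp ipm).
  move: bR bL; apply: filterS2 => w [K hK] [K' hK'].
  apply: (green_lty pp0 pm0 pD (K := K + K') sr) => n.
  apply: le_trans (mgf_le_right_left _ _ _ pp0 pm0 n w) _.
  by rewrite mulrDl; apply: lerD.
by apply/negP; rewrite -ltNge; apply: lt_le_trans aL; rewrite lte_fin /r; lra.
Qed.

End Limit.

Theorem theorem5p2 (R : realType) (d : measure_display) (X : measurableType d)
  (P : probability X R) (T Tinv : X -> X) (pp pm : X -> R) :
  (* T is invertible and bimeasurable *)
  measurable_fun setT T -> measurable_fun setT Tinv ->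
  cancel T Tinv -> cancel Tinv T ->
  (* T preserves P *)
  (forall A, measurable A -> P (T @^-1` A) = P A) ->
  (* T is ergodic *)
  (forall A, measurable A -> T @^-1` A = A -> P A = 0%E \/ P A = 1%E) ->
  (* p^+, p^- : measurable, [0,1]-valued, summing to 1 *)
  measurable_fun setT pp -> measurable_fun setT pm ->
  (forall w, 0 <= pp w <= 1) -> (forall w, 0 <= pm w <= 1) ->
  (forall w, pp w + pm w = 1) ->
  (* integrability of |log p^+| and |log p^-| (log 0 = -oo) *)
  P.-integrable setT (fun w => elog (pp w)) ->
  P.-integrable setT (fun w => elog (pm w)) ->
  forall lam : R,
  {ae P, forall w,
    (fun n : nat => ((n%:R)^-1 * ln (quenched_mgf T Tinv pp pm w lam n))%:E)
      @ \oo --> Lambda P T pp pm lam}.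
Proof.
move=> mT mTinv TK TinvK pres erg mpp mpm pp01 pm01 pD ipp ipm lam.
have ET : ergodic_automorphism P T Tinv by [].
have pp0 w : 0 <= pp w by have /andP[] := pp01 w.
have pm0 w : 0 <= pm w by have /andP[] := pm01 w.
pose v w (n : nat) : R := n%:R^-1 * ln (mgf T Tinv pp pm lam n w).
(* The rationals are enumerated by [unpickle], as almost sure statements are intersected over the
   naturals. *)
have up : {ae P, forall w, forall m (q : rat), unpickle m = Some q ->
    (Lambda P T pp pm lam < (ratr q)%:E)%E -> \forall n \near \oo, v w n <= ratr q}.
  apply: ae_foralln => m; case: (unpickle m) => [q|]; last exact: aeW.
  have [Lq|nLq] := pselect (Lambda P T pp pm lam < (ratr q)%:E)%E.
    have := rate_le_Lambda ET pp0 pm0 pD Lq.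
    by apply: filterS => w h _ [<-].
  by apply: aeW => w _ [<-].
have lo : {ae P, forall w, forall m (q : rat), unpickle m = Some q ->
    ((ratr q)%:E < Lambda P T pp pm lam)%E -> \forall n \near \oo, ratr q <= v w n}.
  apply: ae_foralln => m; case: (unpickle m) => [q|]; last exact: aeW.
  have [Lq|nLq] := pselect ((ratr q)%:E < Lambda P T pp pm lam)%E.
    have := Lambda_le_rate ET mpp mpm pp0 pm0 pD ipp ipm Lq.
    by apply: filterS => w h _ [<-].
  by apply: aeW => w _ [<-].
move: up lo; apply: filterS2 => w up lo.
under eq_fun do rewrite (quenched_mgfE _ _ _ TK TinvK).
by apply: (@cvg_ereal_rat _ (v w)) => q; [apply: up|apply: lo]; exact: pickleK.
Qed.
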